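(* Let $(Q,+,\cdot,\le)$ be any ordered field and $n\ge 2$. For any two distinct relations $\rho,\delta\in\{\tau,\lambda,\sigma\}$, the relation $\delta$ is not definable in the structure $(Q^n,\rho)$ by any first-order formula (with equality) that uses only 3 variables.
   Context: For $p=(p_0,\dots,p_{n-1}),\,q=(q_0,\dots,q_{n-1})\in Q^n$: $p\,\tau\,q$ iff $(p_0-q_0)^2>\sum_{i=1}^{n-1}(p_i-q_i)^2$; $p\,\lambda\,q$ iff $(p_0-q_0)^2=\sum_{i=1}^{n-1}(p_i-q_i)^2$ and $p_0\neq q_0$; $p\,\sigma\,q$ iff $(p_0-q_0)^2<\sum_{i=1}^{n-1}(p_i-q_i)^2$. A formula uses only 3 variables if at most 3 distinct variable symbols (free or bound, possibly re-quantified) occur in it. Definability is without parameters, in the language with one binary relation symbol interpreted as $\rho$ and equality. *)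

(* Defs.v *)
From HB Require Import structures.
From mathcomp Require Import all_boot all_order all_algebra.

Set Implicit Arguments.
Unset Strict Implicit.
Unset Printing Implicit Defensive.

Import Order.TTheory GRing.Theory Num.Theory.
Local Open Scope ring_scope.

Section Relations.
Variables (Q : realFieldType) (n : nat).

(* Points of Q^(n+1): coordinate [ord0] is time and the coordinates
   [lift ord0 i], for [i : 'I_n], are the spatial ones. *)
Implicit Types p q : 'rV[Q]_n.+1.

Definition time2 p q : Q := (p 0 ord0 - q 0 ord0) ^+ 2.

Definition space2 p q : Q :=
  \sum_(i < n) (p 0 (lift ord0 i) - q 0 (lift ord0 i)) ^+ 2.

Definition tau : rel 'rV[Q]_n.+1 := fun p q => time2 p q > space2 p q.

Definition lambda : rel 'rV[Q]_n.+1 :=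
  fun p q => (time2 p q == space2 p q) && (p 0 ord0 != q 0 ord0).

Definition sigma : rel 'rV[Q]_n.+1 := fun p q => time2 p q < space2 p q.

Definition causal (rho : rel 'rV[Q]_n.+1) : Prop :=
  [\/ rho = tau, rho = lambda | rho = sigma].

End Relations.

(* First-order formulas with equality over one binary relation symbol.
   Variables are named (not de Bruijn), so that a variable can be
   re-quantified and distinct variable symbols can be counted. *)
Inductive formula : Type :=
  | FFalse
  | FRel of nat & nat
  | FEq of nat & nat
  | FNot of formula
  | FAnd of formula & formula
  | FOr of formula & formula
  | FImp of formula & formula
  | FForall of nat & formula
  | FExists of nat & formula.

(* All variable symbols occurring in a formula: free, bound, or merely
   quantified. *)
Fixpoint vars (phi : formula) : seq nat :=
  match phi with
  | FFalse => [::]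
  | FRel x y | FEq x y => [:: x; y]
  | FNot f => vars f
  | FAnd f g | FOr f g | FImp f g => vars f ++ vars g
  | FForall x f | FExists x f => x :: vars f
  end.

Fixpoint free_vars (phi : formula) : seq nat :=
  match phi with
  | FFalse => [::]
  | FRel x y | FEq x y => [:: x; y]
  | FNot f => free_vars f
  | FAnd f g | FOr f g | FImp f g => free_vars f ++ free_vars g
  | FForall x f | FExists x f => [seq y <- free_vars f | y != x]
  end.

Definition num_vars (phi : formula) : nat := size (undup (vars phi)).

Fixpoint sat (D : Type) (R : rel D) (phi : formula) (e : nat -> D) : Prop :=
  match phi with
  | FFalse => False
  | FRel x y => R (e x) (e y)
  | FEq x y => e x = e y
  | FNot f => ~ sat R f e
  | FAnd f g => sat R f e /\ sat R g e
  | FOr f g => sat R f e \/ sat R g e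
  | FImp f g => sat R f e -> sat R g e
  | FForall x f => forall a : D, sat R f [eta e with x |-> a]
  | FExists x f => exists a : D, sat R f [eta e with x |-> a]
  end.

(* Definability of [S] in [(D, R)]: [phi] has no free variables other than
   [x] and [y], so no parameters are allowed. *)
Definition definable (k : nat) (D : Type) (R S : rel D) : Prop :=
  exists (phi : formula) (x y : nat),
    [/\ (num_vars phi <= k)%N,
        x != y,
        {subset free_vars phi <= [:: x; y]}
      & forall e : nat -> D, sat R phi e <-> S (e x) (e y)].

(* Main.v *)
(** A bijection between two sets of at most three points which preserves [R] and
equality can always be extended after one pair is dropped, provided that for any
[p != q] all four combinations of [R r p], [R r q] are realised by some [r] other
than [p] and [q]; then a formula in three variables cannot tell apart two
pairs of distinct [R]-unrelated points. Minkowski space over an ordered field has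
this extension property for each of the three relations. Indeed, if [d = q - p] is
nonzero, some null vector [v] is not orthogonal to [d], so that along the line
[q + s v] the squared interval to [q] vanishes while that to [p] is a nonconstant
affine function of [s]; the remaining combinations are realised by points far
away in a timelike or a spacelike direction, and by points of the line through
[p] and [q] if [d] is null. It remains to take a pair related by [delta] and a
pair related by the third relation. *)

Require Import Defs.
From HB Require Import structures.
From mathcomp Require Import all_boot all_order all_algebra.
From mathcomp Require Import ring lra.

Set Implicit Arguments.
Unset Strict Implicit.
Unset Printing Implicit Defensive.

Import Order.TTheory GRing.Theory Num.Theory.
Local Open Scope ring_scope.

(** * Back-and-forth for three variables over one binary relation *)

Section ThreeVariables.
Variables (D : eqType) (R : rel D).

(** Sending [e x] to [e' x] for [x] in [V] is a partial isomorphism; the clause on equality makes it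
    well defined and injective. *)
Definition agree (V : seq nat) (e e' : nat -> D) : Prop :=
  {in V &, forall x y, (e x == e y) = (e' x == e' y) /\
                       R (e x) (e y) = R (e' x) (e' y)}.

Lemma agree_sym V e e' : agree V e e' -> agree V e' e.
Proof. by move=> A x y xV yV; have [-> ->] := A x y xV yV. Qed.

Hypothesis Rirr : irreflexive R.
Hypothesis Rsym : symmetric R.
Hypothesis Rext : forall p q b c, (p == q -> b = c) ->
  exists r, [/\ r != p, r != q, R r p = b & R r q = c].

Lemma agree_extend V e e' a : (size V <= 2)%N -> agree V e e' ->
  exists a', {in V, forall y, (a == e y) = (a' == e' y) /\
                              R a (e y) = R a' (e' y)}.
Proof.
move=> sV A.
have [y [z VP]] : exists y z, {subset V <= [:: y; z]} /\
    (V = [::] \/ (y \in V /\ z \in V)).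
  case: V sV {A} => [|y [|z [|//]]] _.
  - by exists 0%N, 0%N; split; [|left].
  - exists y, y; split; last by right; rewrite mem_head.
    by move=> u; rewrite !inE => ->.
  - by exists y, z; split=> //; right; rewrite !inE !eqxx orbT.
case: VP => sub [-> | [yV zV]]; first by exists a.
have [ay|nay] := eqVneq a (e y).
  by exists (e' y) => u uV; rewrite ay; apply: A.
have [az|naz] := eqVneq a (e z).
  by exists (e' z) => u uV; rewrite az; apply: A.
have [r [ry rz Ry Rz]] :
    exists r, [/\ r != e' y, r != e' z, R r (e' y) = R a (e y)
                & R r (e' z) = R a (e z)].
  (* If [e' y = e' z], then [e y = e z] by agreement, so the two prescribed values coincide. *)
  by apply: Rext; have [<- _] := A y z yV zV => /eqP ->.
exists r => u /sub; rewrite !inE => /orP[] /eqP ->.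
  by rewrite (negbTE nay) (negbTE ry) Ry.
by rewrite (negbTE naz) (negbTE rz) Rz.
Qed.

(** Requantifying [x] frees its old value, so at most two other points constrain the new one. This
    is where the bound of three variables enters. *)
Lemma agree_update V e e' x a : uniq V -> (size V <= 3)%N -> x \in V ->
  agree V e e' ->
  exists a', agree V [eta e with x |-> a] [eta e' with x |-> a'].
Proof.
move=> uV sV xV A.
have sW : (size (rem x V) <= 2)%N by rewrite size_rem //; case: (size V) sV.
have AW : agree (rem x V) e e'.
  by move=> y z /mem_rem yV /mem_rem zV; apply: A.
have [a' Ha'] := agree_extend a sW AW.
have H y : y \in V -> y != x ->
    (a == e y) = (a' == e' y) /\ R a (e y) = R a' (e' y).
  by move=> yV yx; apply: Ha'; rewrite mem_rem_uniq // !inE yx yV.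
exists a' => y z yV zV /=.
case: (eqVneq y x) => [_|yx]; case: (eqVneq z x) => [_|zx].
- by rewrite !eqxx !Rirr.
- exact: H.
- by rewrite eq_sym Rsym (eq_sym (e' y)) (Rsym (e' y)); apply: H.
- exact: A.
Qed.

(** Induction on [phi] with [V] fixed: each quantifier is one back-and-forth move, and [agree_sym]
    gives the opposite direction. *)
Lemma sat_agree V phi e e' : uniq V -> (size V <= 3)%N ->
  {subset vars phi <= V} -> agree V e e' -> sat R phi e <-> sat R phi e'.
Proof.
move=> uV sV.
have catW (s t : seq nat) : {subset s ++ t <= V} ->
    {subset s <= V} /\ {subset t <= V}.
  by move=> st; split=> u us; apply: st; rewrite mem_cat us ?orbT.
have consW x (s : seq nat) : {subset x :: s <= V} -> x \in V /\ {subset s <= V}.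
  move=> xs; split=> [|u us]; first by apply: xs; rewrite mem_head.
  by apply: xs; rewrite inE us orbT.
elim: phi e e' => [|x y|x y|f IH|f IHf g IHg|f IHf g IHg|f IHf g IHg|x f IH|x f IH]
  e e' /=.
- by [].
- move=> /consW[xV /consW[yV _]] A.
  by have [_ ->] := A x y xV yV.
- move=> /consW[xV /consW[yV _]] A.
  have [E _] := A x y xV yV.
  by split=> /eqP H; apply/eqP; move: H; rewrite E.
- by move=> /IH{}IH /IH[H1 H2]; split=> N /[dup] => [/H2|_ /H1].
- by move=> /catW[/IHf{}IHf /IHg{}IHg] A; rewrite (IHf _ _ A) (IHg _ _ A).
- by move=> /catW[/IHf{}IHf /IHg{}IHg] A; rewrite (IHf _ _ A) (IHg _ _ A).
- by move=> /catW[/IHf{}IHf /IHg{}IHg] A; rewrite (IHf _ _ A) (IHg _ _ A).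
- move=> /consW[xV /IH{}IH] A; split=> H a.
    have [a' A'] := agree_update a uV sV xV (agree_sym A).
    by apply/(IH _ _ A').
  have [a' A'] := agree_update a uV sV xV A.
  by apply/(IH _ _ A').
- move=> /consW[xV /IH{}IH] A; split=> -[a H].
    have [a' A'] := agree_update a uV sV xV A.
    by exists a'; apply/(IH _ _ A').
  have [a' A'] := agree_update a uV sV xV (agree_sym A).
  by exists a'; apply/(IH _ _ A').
Qed.

Lemma not_definable3 (S : rel D) p q p' q' :
  p != q -> R p q = false -> S p q ->
  p' != q' -> R p' q' = false -> S p' q' = false ->
  ~ definable 3 R S.
Proof.
move=> pq Rpq Spq pq' Rpq' Spq' [phi [x [y [k3 xy _ phiP]]]].
(* Every variable except [x] gets the second point, so agreement on all of [vars phi] reduces to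
   comparing the two pairs. *)
pose e u := if u == x then p else q; pose e' u := if u == x then p' else q'.
have A : agree (undup (vars phi)) e e'.
  move=> u v _ _; rewrite /e /e'.
  case: (u == x); case: (v == x); rewrite ?eqxx ?Rirr //.
    by rewrite (negbTE pq) (negbTE pq') Rpq Rpq'.
  by rewrite !(eq_sym q) !(eq_sym q') !(Rsym q) !(Rsym q')
    (negbTE pq) (negbTE pq') Rpq Rpq'.
have sub : {subset vars phi <= undup (vars phi)} by move=> u; rewrite mem_undup.
have E := sat_agree (undup_uniq _) k3 sub A.
have : S (e' x) (e' y) by apply/phiP/E/phiP; rewrite /e eqxx eq_sym (negbTE xy).
by rewrite /e' eqxx eq_sym (negbTE xy) Spq'.
Qed.

End ThreeVariables.

(** * The Minkowski form over an ordered field *)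

Section Minkowski.
Variables (Q : realFieldType) (n : nat).
Implicit Types (p q r u v w : 'rV[Q]_n.+2) (s k : Q).

Definition mink u v : Q :=
  u 0 ord0 * v 0 ord0 - \sum_(i < n.+1) u 0 (lift ord0 i) * v 0 (lift ord0 i).

Definition mink2 u : Q := mink u u.

Lemma minkC u v : mink u v = mink v u.
Proof.
by rewrite /mink mulrC; congr (_ - _); apply: eq_bigr => i _; rewrite mulrC.
Qed.

Lemma minkDr u v w : mink u (v + w) = mink u v + mink u w.
Proof.
rewrite /mink mxE mulrDr.
under eq_bigr => i _ do rewrite mxE mulrDr.
by rewrite big_split /= opprD addrACA.
Qed.

Lemma minkZr u s v : mink u (s *: v) = s * mink u v.
Proof.
rewrite /mink mxE mulrCA mulrBr mulr_sumr; congr (_ - _).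
by apply: eq_bigr => i _; rewrite mxE mulrCA.
Qed.

Lemma mink2DZ u s v :
  mink2 (u + s *: v) = mink2 u + 2 * s * mink u v + s ^+ 2 * mink2 v.
Proof.
rewrite /mink2 minkDr minkZr !(minkC (u + _)) !minkDr !minkZr.
by rewrite (minkC v u); ring.
Qed.

Lemma mink2Z s v : mink2 (s *: v) = s ^+ 2 * mink2 v.
Proof. by rewrite /mink2 minkZr minkC minkZr mulrA. Qed.

Lemma mink2_0 : mink2 0 = 0.
Proof. by rewrite -(scale0r 0) mink2Z expr0n mul0r. Qed.

Lemma mink2_neq0 u : mink2 u != 0 -> u != 0.
Proof. by apply: contra_neq => ->; exact: mink2_0. Qed.

Lemma mink2_sub p q : mink2 (p - q) = time2 p q - space2 p q.
Proof.
rewrite /mink2 /mink /time2 /space2 !mxE expr2; congr (_ - _).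
by apply: eq_bigr => i _; rewrite !mxE expr2.
Qed.

Lemma mink2_subC p q : mink2 (p - q) = mink2 (q - p).
Proof. by rewrite -opprB -scaleN1r mink2Z sqrrN expr1n mul1r. Qed.

Definition evec (i : 'I_n.+2) : 'rV[Q]_n.+2 := delta_mx 0 i.

Lemma mink_evec0 u : mink u (evec ord0) = u 0 ord0.
Proof.
rewrite /mink big1 => [|i _]; last by rewrite mxE andbC /= mulr0.
by rewrite mxE !eqxx mulr1 subr0.
Qed.

Lemma mink_evecS u i : mink u (evec (lift ord0 i)) = - u 0 (lift ord0 i).
Proof.
rewrite /mink mxE /= mulr0 (bigD1 i) //= mxE !eqxx mulr1 big1 => [|j ji].
  by rewrite addr0 sub0r.
by rewrite mxE /= (inj_eq lift_inj) (negbTE ji) mulr0.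
Qed.

Lemma mink2_evec0 : mink2 (evec ord0) = 1.
Proof. by rewrite /mink2 mink_evec0 mxE !eqxx. Qed.

Lemma mink2_evecS i : mink2 (evec (lift ord0 i)) = -1.
Proof. by rewrite /mink2 mink_evecS mxE !eqxx. Qed.

Lemma mink2_null i s : s ^+ 2 = 1 -> mink2 (evec ord0 + s *: evec (lift ord0 i)) = 0.
Proof.
by move=> s2; rewrite mink2DZ mink2_evec0 mink_evecS mink2_evecS s2 mxE /=; ring.
Qed.

(** The null vectors [evec ord0] plus or minus [evec (lift ord0 i)] suffice: if [u] were orthogonal
    to all of them, its time coordinate would equal each spatial one and its opposite, forcing
    [u = 0]. *)
Lemma null_nonorthogonal u : u != 0 -> exists2 v, mink2 v = 0 & mink u v != 0.
Proof.
move=> u0.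
have [i ui] : exists i, u 0 ord0 != u 0 (lift ord0 i) \/
                        u 0 ord0 != - u 0 (lift ord0 i).
  have [E|] := eqVneq (u 0 ord0) 0; last first.
    move=> t0; exists ord0; case: eqVneq => [E|]; [right | by left].
    by apply: contra_neq t0; rewrite -E; lra.
  move: u0 => /rV0Pn[j]; case: (unliftP ord0 j) => [i ->|->]; last by rewrite E eqxx.
  by exists i; left; rewrite E eq_sym.
case: ui => ui.
  exists (evec ord0 + 1 *: evec (lift ord0 i)); first by rewrite mink2_null // expr1n.
  by rewrite minkDr minkZr mink_evec0 mink_evecS mul1r subr_eq0.
exists (evec ord0 + (-1) *: evec (lift ord0 i)).
  by rewrite mink2_null // sqrrN expr1n.
by rewrite minkDr minkZr mink_evec0 mink_evecS mulrN mulN1r opprK addr_eq0.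
Qed.

(** * Points whose intervals to given points are prescribed *)

Definition sign k := k \in [:: 1; 0; -1].

Lemma sign_norm k : sign k -> k != 0 -> `|k| = 1.
Proof.
by rewrite /sign !inE => /or3P[] /eqP ->; rewrite ?eqxx ?normrN ?normr1.
Qed.

Lemma sgr_unit k : `|k| = 1 -> Num.sg k = k.
Proof. by move=> k1; rewrite [RHS]numEsg k1 mulr1. Qed.

Lemma sgr_sign k : sign k -> Num.sg k = k.
Proof.
by rewrite /sign !inE => /or3P[] /eqP ->; rewrite ?sgrN ?sgr1 ?sgr0.
Qed.

Lemma exists_mink2 k : sign k -> exists2 v, v != 0 & mink2 v = k.
Proof.
rewrite /sign !inE => /or3P[] /eqP ->.
- exists (evec ord0); last exact: mink2_evec0.
  by rewrite mink2_neq0 // mink2_evec0 oner_neq0.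
- exists (evec ord0 + 1 *: evec (lift ord0 ord0)).
    apply/eqP => /matrixP /(_ 0 ord0) /eqP.
    by rewrite !mxE /= mulr0 addr0 oner_eq0.
  by rewrite mink2_null // expr1n.
- exists (evec (lift ord0 ord0)); last exact: mink2_evecS.
  by rewrite mink2_neq0 // mink2_evecS oppr_eq0 oner_neq0.
Qed.

(** Moving [q] by [s *: v], with [v] null and not orthogonal to [q - p], changes the interval to [p]
    affinely in [s] with nonzero slope, so [s] can be solved for. The condition on [c] rules out
    [r = q]. *)
Lemma null_shift p q c : p != q -> c != mink2 (q - p) ->
  exists r, [/\ r != q, mink2 (r - q) = 0 & mink2 (r - p) = c].
Proof.
move=> pq cN; have qp0 : q - p != 0 by rewrite subr_eq0 eq_sym.
have [v v0 vd] := null_nonorthogonal qp0.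
pose s := (c - mink2 (q - p)) / (2 * mink (q - p) v).
have rp : mink2 (q - p + s *: v) = c.
  by rewrite mink2DZ v0 /s; field.
exists (q + s *: v); split.
- by apply: contra_neq cN => E; rewrite -rp addrAC E.
- by rewrite addrC addKr mink2Z v0 mulr0.
- by rewrite addrAC.
Qed.

(* A quadratic polynomial whose leading coefficient is [1] or [-1] eventually has
   the sign of that coefficient. *)
Lemma far_point p q k : `|k| = 1 ->
  exists r, Num.sg (mink2 (r - p)) = k /\ Num.sg (mink2 (r - q)) = k.
Proof.
move=> k1; have sgk := sgr_unit k1.
have sk : sign k.
  have := eqxx `|k|; rewrite {2}k1 eqr_norml ler01 andbT /sign !inE.
  by case/orP=> ->; rewrite ?orbT.
have [v _ vk] := exists_mink2 sk.
pose a := mink2 (p - q); pose b := mink (p - q) v.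
(* Chosen so that [s ^+ 2] exceeds the absolute value of [a + 2 * s * b], the part of the quadratic
   of lower degree in [s]. *)
pose s := 1 + `|a| + 2 * `|b|.
have a0 := normr_ge0 a; have b0 := normr_ge0 b.
have s1 : 1 <= s by rewrite /s; lra.
exists (p + s *: v); split.
  by rewrite addrC addKr mink2Z vk sgrM sgk gtr0_sg ?mul1r // exprn_gt0 //; lra.
rewrite addrAC mink2DZ vk -/a -/b.
have H : `|a + 2 * s * b| < s ^+ 2.
  apply: (@le_lt_trans _ _ (`|a| + 2 * s * `|b|)).
    have s2 : 0 < 2 * s by lra.
    by rewrite (le_trans (ler_normD _ _)) // normrM (gtr0_norm s2).
  have -> : s ^+ 2 = s + `|a| * s + 2 * s * `|b| by rewrite expr2 {2}/s; ring.
  by have := ler_peMr a0 s1; lra.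
move: sk H; rewrite ltr_norml => + /andP[H1 H2].
rewrite /sign !inE => /or3P[] /eqP K.
- by rewrite K gtr0_sg //; lra.
- by move: k1; rewrite K normr0 => /eqP; rewrite eq_sym oner_eq0.
- by rewrite K ltr0_sg //; lra.
Qed.

(** * The three relations as one family indexed by sign, and their extension property *)

Definition cone k : rel 'rV[Q]_n.+2 :=
  fun p q => (p != q) && (Num.sg (mink2 (p - q)) == k).

Lemma cone_irr k : irreflexive (cone k).
Proof. by move=> p; rewrite /cone eqxx. Qed.

Lemma cone_sym k : symmetric (cone k).
Proof. by move=> p q; rewrite /cone eq_sym mink2_subC. Qed.

Lemma cone_ext_neq k p q b c : sign k -> p != q ->
  exists r, [/\ r != p, r != q, cone k r p = b & cone k r q = c].
Proof.
move=> sk pq.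
pose realised x y := exists r, [/\ r != p, r != q,
  Num.sg (mink2 (r - p)) = x & Num.sg (mink2 (r - q)) = y].
suff [x [y [[r [rp rq rx ry]] <- <-]]] :
    exists x y, [/\ realised x y, (x == k) = b & (y == k) = c].
  by exists r; rewrite /cone rp rq rx ry.
have neq r u l : `|l| = 1 -> Num.sg (mink2 (r - u)) = l -> r != u.
  move=> l1 E; rewrite -subr_eq0 mink2_neq0 // -sgr_eq0 E.
  by rewrite -normr_eq0 l1 oner_neq0.
have far l : `|l| = 1 -> realised l l.
  move=> l1; have [r [rp rq]] := far_point p q l1.
  by exists r; split=> //; apply: neq l1 _.
have near u w l : u != w -> `|l| = 1 -> exists r, [/\ r != u, r != w,
    Num.sg (mink2 (r - u)) = l & Num.sg (mink2 (r - w)) = 0].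
  (* This value has sign [l] and is larger in absolute value than [mink2 (w - u)], hence different
     from it, as [null_shift] requires. *)
  move=> uw l1; pose m := l * (1 + `|mink2 (w - u)|).
  have mp : 0 < 1 + `|mink2 (w - u)| by rewrite ltr_wpDr.
  have mN : m != mink2 (w - u).
    apply/eqP => /(congr1 Num.norm); rewrite normrM l1 mul1r (gtr0_norm mp).
    by lra.
  have [r [rw r0 ru]] := null_shift uw mN.
  have sgu : Num.sg (mink2 (r - u)) = l.
    by rewrite ru sgrM (sgr_unit l1) (gtr0_sg mp) mulr1.
  by exists r; rewrite sgu r0 sgr0; split=> //; apply: neq l1 sgu.
have nearl l : `|l| = 1 -> realised l 0 by exact: near.
have nearr l : `|l| = 1 -> realised 0 l.
  by move=> /(near q p); rewrite eq_sym => /(_ pq) [r [rq rp x y]]; exists r.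
have null : realised 0 0.
  (* If [q - p] is not null, a null shift to interval 0 works; otherwise the point [q + (q - p)] of
     the null line through [p] and [q] does. *)
  have [d0|d0] := eqVneq (mink2 (q - p)) 0; last first.
    have [|r [rq r0 rp]] := null_shift (c := 0) pq; first by rewrite eq_sym.
    exists r; rewrite r0 rp sgr0; split=> //.
    by apply: contra_neq d0 => <-; rewrite mink2_subC.
  have dn : q - p != 0 by rewrite subr_eq0 eq_sym.
  have E1 : q + (q - p) - p = 2%:R *: (q - p).
    by rewrite scaler_nat mulr2n addrAC.
  have E2 : q + (q - p) - q = q - p by rewrite addrC addKr.
  exists (q + (q - p)); rewrite -subr_eq0 E1 -(subr_eq0 _ q) E2.
  by rewrite scaler_eq0 pnatr_eq0 mink2Z d0 mulr0 sgr0.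
(* The value [false] is realised by a sign other than [k]: by 1 when [k = 0]; otherwise by 0 when
   only one value is [false], and by [- k] when both are. So opposite nonzero signs never have to be
   combined. *)
have [->|/(sign_norm sk) k1] := eqVneq k 0.
  have n1 : `|1 : Q| = 1 := normr1 _.
  have D : (1 == 0 :> Q) = false by rewrite oner_eq0.
  by case: b; case: c; [exists 0, 0 | exists 0, 1 | exists 1, 0 | exists 1, 1];
    rewrite ?eqxx ?D; split; auto.
have k0 : (0 == k) = false by rewrite eq_sym -normr_eq0 k1 oner_eq0.
have kN : (- k == k) = false by rewrite eq_sym -addr_eq0 -mulr2n mulrn_eq0 /= eq_sym.
have Nk1 : `|- k| = 1 by rewrite normrN.
by case: b; case: c; [exists k, k | exists k, 0 | exists 0, k | exists (- k), (- k)];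
  rewrite ?eqxx ?k0 ?kN; split; auto.
Qed.

Lemma cone_ext k p q b c : sign k -> (p == q -> b = c) ->
  exists r, [/\ r != p, r != q, cone k r p = b & cone k r q = c].
Proof.
move=> sk; have [<- /(_ isT) <-|pq _] := eqVneq p q; last exact: cone_ext_neq.
(* When [p = q], an auxiliary second point [p + v] reduces to the case of distinct points. *)
have [v v0 _] := exists_mink2 sk.
have pv : p != p + v by rewrite eq_sym -subr_eq0 addrC addKr.
by have [r [rp _ rb _]] := cone_ext_neq b b sk pv; exists r.
Qed.

Lemma cone_neq k p q : k != 0 ->
  cone k p q = (Num.sg (mink2 (p - q)) == k).
Proof.
move=> k0; rewrite /cone; have [->|//] := eqVneq p q.
by rewrite subrr mink2_0 sgr0 eq_sym (negbTE k0).
Qed.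

Lemma tau_cone : @tau Q n.+1 =2 cone 1.
Proof.
by move=> p q; rewrite cone_neq ?oner_neq0 // sgr_cp0 mink2_sub subr_gt0.
Qed.

Lemma sigma_cone : @sigma Q n.+1 =2 cone (-1).
Proof.
move=> p q; rewrite cone_neq ?oppr_eq0 ?oner_neq0 //.
by rewrite sgr_cp0 mink2_sub subr_lt0.
Qed.

(** For a null difference, equal times make the spatial sum of squares vanish, so all coordinates
    agree; thus distinct times amount to distinct points. *)
Lemma lambda_cone : @lambda Q n.+1 =2 cone 0.
Proof.
move=> p q; rewrite /cone /lambda sgr_eq0 mink2_sub subr_eq0 andbC.
have [E|_] := eqVneq (time2 p q) (space2 p q); last by rewrite !andbF.
rewrite !andbT; congr negb.
apply/eqP/eqP => [t0|-> //]; apply/rowP => j.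
have S0 : space2 p q = 0 by rewrite -E /time2 t0 subrr expr0n.
case: (unliftP ord0 j) => [i ->|-> //].
have /eqP : (p 0 (lift ord0 i) - q 0 (lift ord0 i)) ^+ 2 = 0.
  by apply: (psumr_eq0P _ S0) => // i0 _; rewrite sqr_ge0.
by rewrite sqrf_eq0 subr_eq0 => /eqP.
Qed.

(** Vectors of squared length [l] and [m], each paired with the origin, are both unrelated by [rho],
    but [delta] holds only for the first pair. *)
Lemma cone_not_definable k l m (rho delta : rel 'rV[Q]_n.+2) :
  sign k -> sign l -> sign m -> k != l -> k != m -> l != m ->
  rho =2 cone k -> delta =2 cone l -> ~ definable 3 rho delta.
Proof.
move=> sk sl sm kl km lm rk dl.
have cone0 i j v : sign i -> v != 0 -> mink2 v = i -> cone j v 0 = (i == j).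
  by move=> si v0 vi; rewrite /cone v0 subr0 vi sgr_sign.
have [u u0 ul] := exists_mink2 sl.
have [v v0 vm] := exists_mink2 sm.
apply: (@not_definable3 _ rho _ _ _ delta u 0 v 0) => //.
- by move=> p; rewrite rk cone_irr.
- by move=> p q; rewrite !rk cone_sym.
- move=> p q b c pq; have [r [rp rq rb rc]] := cone_ext sk pq.
  by exists r; rewrite !rk.
- by rewrite rk (cone0 l) // eq_sym (negbTE kl).
- by rewrite dl (cone0 l).
- by rewrite rk (cone0 m) // eq_sym (negbTE km).
- by rewrite dl (cone0 m) // eq_sym (negbTE lm).
Qed.

End Minkowski.

Theorem theorem3p7 (Q : realFieldType) (n : nat)
    (rho delta : rel 'rV[Q]_n.+2) :
  causal rho -> causal delta -> rho <> delta ->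
  ~ definable 3 rho delta.
Proof.
have S1 : sign (1 : Q) by rewrite /sign !inE eqxx.
have S0 : sign (0 : Q) by rewrite /sign !inE eqxx orbT.
have SN : sign (-1 : Q) by rewrite /sign !inE eqxx !orbT.
have D10 : 1 != 0 :> Q by rewrite oner_neq0.
have DN0 : -1 != 0 :> Q by rewrite oppr_eq0.
have D1N : 1 != -1 :> Q by rewrite -addr_eq0 -mulr2n pnatr_eq0.
have T := @tau_cone Q n; have L := @lambda_cone Q n; have S := @sigma_cone Q n.
(* Equal relations are excluded by hypothesis; in the six other cases the last sign supplied is that
   of the third relation. *)
case=> -> [] -> // _.
- by apply: (@cone_not_definable _ _ 1 0 (-1)); rewrite // eq_sym.
- by apply: (@cone_not_definable _ _ 1 (-1) 0); rewrite // eq_sym.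
- by apply: (@cone_not_definable _ _ 0 1 (-1)); rewrite // eq_sym.
- by apply: (@cone_not_definable _ _ 0 (-1) 1); rewrite // eq_sym.
- by apply: (@cone_not_definable _ _ (-1) 1 0); rewrite // eq_sym.
- by apply: (@cone_not_definable _ _ (-1) 0 1); rewrite // eq_sym.
Qed.
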